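(* Let $T=AB\in\mathcal L_l^{+2}(\mathfrak H)$ with $A\in B^+(\mathfrak H)$ and $B=B^*\ge0$. Then $(A^{1/2}BA^{1/2})^*=A^{1/2}BA^{1/2}$ and $T$ is pre-similar to $A^{1/2}BA^{1/2}$ with intertwining operator $A^{1/2}$. Moreover, if $\rho(T)\neq\emptyset$, then $$\sigma(T)=\sigma(A^{1/2}BA^{1/2})\subseteq[0,\infty).$$
   Context: $\mathfrak H$ is a complex Hilbert space; $B(\mathfrak H)$ denotes the bounded everywhere defined operators and $B^+(\mathfrak H)$ the nonnegative selfadjoint ones among them. $\mathcal L_l^{+2}(\mathfrak H)$ is the class of closed operators $T$ in $\mathfrak H$ of the form $T=AB$ with $A\in B^+(\mathfrak H)$ and $B=B^*\ge0$ (in general unbounded). Products of operators have their natural domains. An operator $T$ is pre-similar to an operator $S$ with intertwining operator $G\in B(\mathfrak H)$ if $TG=GS$. For a closed operator $T$, $\rho(T)$ is the set of $\mu\in\mathbb C$ with $(T-\mu I)^{-1}\in B(\mathfrak H)$, and $\sigma(T)=\mathbb C\setminus\rho(T)$. *)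

(* Defs.v *)
From HB Require Import structures.
From mathcomp Require Import all_boot all_order all_algebra.
From mathcomp Require Import sesquilinear.
From mathcomp Require Import complex.
From mathcomp Require Import boolp classical_sets functions reals.
From mathcomp Require Import topology normedtype.

Set Implicit Arguments.
Unset Strict Implicit.
Unset Printing Implicit Defensive.

Import Order.TTheory GRing.Theory Num.Theory.
Import numFieldNormedType.Exports.

Local Open Scope classical_set_scope.
Local Open Scope ring_scope.

(* The inner product is linear in its first argument.                         *)
HB.mixin Record CompleteNormedModule_isHilbert (R : realType) V
    of CompleteNormedModule R[i] V := {
  hdot : {dot V for @Num.conj R[i]} ;
  hdot_norm : forall x : V, `|x| ^+ 2 = hdot x x }.

#[short(type="hilbertType")]
HB.structure Definition Hilbert (R : realType) :=
  { V of CompleteNormedModule R[i] V & CompleteNormedModule_isHilbert R V }.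

Section LinearOperators.
Context {R : realType} {H : hilbertType R}.
Local Notation "''[' x , y ]" := (hdot x y) : ring_scope.

Implicit Types (T S : set (H * H)) (A G Q : {linear H -> H}) (mu : R[i]).

(* A possibly unbounded operator is represented by its graph, so that         *)
(* equality of operators, domains included, is equality of sets.              *)
Definition is_operator T :=
  [/\ T (0, 0),
      forall (a : R[i]) p q, T p -> T q -> T (a *: p + q) &
      forall x y z, T (x, y) -> T (x, z) -> y = z].

Definition dom T : set H := [set x | exists y, T (x, y)].

Definition graph (f : H -> H) : set (H * H) := [set p | p.2 = f p.1].

(* The product T S (S acts first): its domain is {x in dom S | S x in dom T}. *)
Definition mulop T S : set (H * H) :=
  [set p | exists2 y, S (p.1, y) & T (y, p.2)].

(* T - mu I, with domain dom T. *)
Definition shiftop T mu : set (H * H) :=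
  [set p | exists2 y, T (p.1, y) & p.2 = y - mu *: p.1].

Definition invop T : set (H * H) := [set p | T (p.2, p.1)].

(* For an operator T, this is the graph of an operator iff dom T is dense.    *)
Definition adjoint T : set (H * H) :=
  [set p | forall x y, T (x, y) -> '[y, p.1] = '[x, p.2]].

Definition selfadjoint T :=
  [/\ is_operator T, dense (dom T) & adjoint T = T].

Definition nonneg T := forall x y, T (x, y) -> 0 <= '[y, x].

Definition bounded_op (f : H -> H) :=
  exists M : R[i], forall x, `|f x| <= M * `|x|.

(* The class B^+(H). *)
Definition bounded_nonneg A :=
  [/\ bounded_op A, selfadjoint (graph A) & nonneg (graph A)].

Definition is_sqrt A Q := bounded_nonneg Q /\ forall x, Q (Q x) = A x.

(* A^(1/2): for A in B^+(H) there is exactly one Q with is_sqrt A Q; the      *)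
(* value when there is none is irrelevant.                                    *)
Definition sqrtop A : {linear H -> H} :=
  if pselect (exists Q, is_sqrt A Q) is left e then projT1 (cid e) else A.

(* The class L_l^{+2}(H). *)
Definition Llplus2 T :=
  closed T /\
  exists (A : {linear H -> H}) (B : set (H * H)),
    [/\ bounded_nonneg A, selfadjoint B, nonneg B & T = mulop (graph A) B].

Definition presimilar T S G :=
  bounded_op G /\ mulop T (graph G) = mulop (graph G) S.

Definition resolvent_set T : set R[i] :=
  [set mu | exists2 Q : {linear H -> H},
     bounded_op Q & invop (shiftop T mu) = graph Q].

Definition spectrum T : set R[i] := ~` resolvent_set T.

End LinearOperators.

(* Main.v *)
Require Import Defs.
From HB Require Import structures.
From mathcomp Require Import all_boot all_order all_algebra.
From mathcomp Require Import complex boolp classical_sets functions reals.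
From mathcomp Require Import topology normedtype.
From mathcomp Require Import sesquilinear ring lra.

(** Write [S] for the square root of [A] and [C] for [S B S]. The intertwining
relation [(A B) S = S (S B S)] is associativity once [A = S S].

Self-adjointness of [C] comes from the closedness of [T = A B]. Since [A] is
bounded, the adjoint of [T] is [B A], and since [T] is closed, [T] is the
adjoint of [B A] ([biadjoint], [leftprod_of_adjoint]). In particular the domain
of [B A] is dense, which gives the density of the domain of [C]. If [(u, v)]
lies in the adjoint of [C], testing against the vectors [S w], with [w] in the
domain of [B A], shows that [(S u, S v)] lies in the adjoint of [B A], that is,
[S u] is in the domain of [B] and [S (v - S B S u) = 0]. Both [v] and
[S B S u] are orthogonal to the kernel of [S], hence [v = S B S u].

The spectrum of a nonnegative self-adjoint operator lies in the nonnegative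
half-line because, off this half-line, [C - mu] is bounded below and has dense
range ([nonneg_selfadjoint_resolvent]). The equality of the spectra is pure
algebra once the closed graph theorem ([closed_graph]) has reduced membership
in the resolvent set of a closed operator to bijectivity ([resolventP]). For
[mu != 0], solutions of [(T - mu) x = f] and of [(C - mu) z = g] are exchanged
by the formulas [x = S z] and [z = mu^-1 S B x], as for the products of two
bounded operators in either order. In one direction these formulas only reach
right-hand sides [f] in the domain of [B]; a point [nu] of the resolvent set of
[T] removes this restriction, because
[f - (T - mu) (T - nu)^-1 f = (mu - nu) (T - nu)^-1 f] lies in this domain. For
[mu = 0], bijectivity of [T] or of [C] forces [S] to be bijective, so that [T]
and [C] are similar.

The three results on Hilbert spaces that this uses are proved first:
orthogonal projection in the square of the space ([projection]), the closed
graph theorem by a gliding hump ([weakly_bounded]), and the existence of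
square roots, for which [A] is rescaled to a contraction and [I - S] is the
limit of the iteration [Y := (I - A + Y^2) / 2] ([sqrt_exists]). *)

Set Implicit Arguments.
Unset Strict Implicit.
Unset Printing Implicit Defensive.

Import Order.TTheory GRing.Theory Num.Theory.
Import numFieldNormedType.Exports.
Local Open Scope classical_set_scope.
Local Open Scope ring_scope.

Local Notation "''[' x , y ]" := (hdot x y) : ring_scope.
Local Notation Re := complex.Re.

(** * Real-valued norm and inner product *)

Section Geometry.
Context {R : realType} {H : hilbertType R}.
Implicit Types (x y z : H) (a b : R[i]) (t : R).

(** Norms and real parts are taken in [R] rather than in [R[i]], whose order is
only partial, so that inequalities can be decided by linear arithmetic. *)
Definition hnorm x : R := Re `|x|.
Definition rdot x y : R := Re '[x, y].

Lemma ReD a b : Re (a + b) = Re a + Re b.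
Proof. by case: a b => [? ?] [? ?]. Qed.
Lemma ReN a : Re (- a) = - Re a.
Proof. by case: a. Qed.
Lemma ReZ t a : Re (t%:C%C * a) = t * Re a.
Proof. by case: a => u v /=; rewrite mul0r subr0. Qed.
Lemma conjcD a b : conjc (a + b) = conjc a + conjc b.
Proof. exact: rmorphD. Qed.
Lemma conjcN a : conjc (- a) = - conjc a.
Proof. exact: rmorphN. Qed.

Lemma half_add_half : (2^-1)%:C%C + (2^-1)%:C%C = 1 :> R[i].
Proof. by rewrite -rmorphD -(rmorph1 (real_complex R)); congr (_%:C%C); field. Qed.

Lemma inv_succ_small (c eps : R) : 0 < eps -> exists n, c * n.+1%:R^-1 < eps.
Proof.
move=> e0; exists (Num.truncn (c / eps)).
have := truncnS_gt (c / eps); rewrite ltr_pdivrMr// mulrC => h.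
by rewrite ltr_pdivrMr// mulrC.
Qed.

Lemma hdotC x y : '[x, y] = conjc '[y, x].
Proof. by rewrite hermC expr0 mul1r. Qed.
Lemma hdotZr a x y : '[x, a *: y] = conjc a * '[x, y].
Proof. by rewrite linearZr_LR. Qed.
Lemma hdotZl a x y : '[a *: x, y] = a * '[x, y].
Proof. by rewrite linearZl_LR. Qed.
Lemma hdotDl x y z : '[x + y, z] = '[x, z] + '[y, z].
Proof. exact: linearDl. Qed.
Lemma hdotNl x z : '[- x, z] = - '[x, z].
Proof. exact: linearNl. Qed.
Lemma hdotDr x y z : '[z, x + y] = '[z, x] + '[z, y].
Proof. exact: linearDr. Qed.
Lemma hdotNr x z : '[z, - x] = - '[z, x].
Proof. exact: linearNr. Qed.
Lemma hdot0r x : '[x, 0] = 0.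
Proof. exact: linear0r. Qed.
Lemma hdot0l x : '[0, x] = 0.
Proof. exact: linear0l. Qed.

Lemma hnormE x : `|x| = (hnorm x)%:C%C.
Proof. by rewrite /hnorm RRe_real ?normr_real. Qed.

Lemma hnorm_ge0 x : 0 <= hnorm x.
Proof. by rewrite -ler0c -hnormE. Qed.

Lemma hnorm_eq0 x : hnorm x = 0 -> x = 0.
Proof. by move=> h; apply/eqP; rewrite -normr_eq0 hnormE h. Qed.

Lemma hnorm_gt0 x : x != 0 -> 0 < hnorm x.
Proof.
move=> x0; rewrite lt_def hnorm_ge0 andbT.
by apply: contra_neq x0; exact: hnorm_eq0.
Qed.

Lemma hnorm0 : hnorm 0 = 0.
Proof. by rewrite /hnorm normr0. Qed.

Lemma hnormN x : hnorm (- x) = hnorm x.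
Proof. by rewrite /hnorm normrN. Qed.

Lemma hnormB x y : hnorm (x - y) = hnorm (y - x).
Proof. by rewrite -hnormN opprB. Qed.

Lemma hnormD x y : hnorm (x + y) <= hnorm x + hnorm y.
Proof. by rewrite -lecR rmorphD/= -!hnormE ler_normD. Qed.

Lemma hnormZ a x : hnorm (a *: x) = Re `|a| * hnorm x.
Proof.
by apply: complexI; rewrite -hnormE normrZ hnormE rmorphM -[`|a|]RRe_real ?normr_real.
Qed.

Lemma hnormZr t x : hnorm (t%:C%C *: x) = `|t| * hnorm x.
Proof. by rewrite hnormZ normc_def /= expr0n addr0 sqrtr_sqr. Qed.

Lemma hnormZi x : hnorm ('i%C *: x) = hnorm x.
Proof. by rewrite hnormZ normc_def /= expr0n expr1n add0r sqrtr1 mul1r. Qed.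

Lemma hdotxx x : '[x, x] = (hnorm x ^+ 2)%:C%C.
Proof. by rewrite -hdot_norm hnormE rmorphXn. Qed.

Lemma hdotxx_eq0 x : '[x, x] = 0 -> x = 0.
Proof.
rewrite hdotxx => /(congr1 (@complex.Re R)) /= /eqP; rewrite sqrf_eq0 => /eqP.
exact: hnorm_eq0.
Qed.

Lemma rdotxx x : rdot x x = hnorm x ^+ 2.
Proof. by rewrite /rdot hdotxx. Qed.

Lemma rdotC x y : rdot x y = rdot y x.
Proof. by rewrite /rdot hdotC; case: '[_, _]. Qed.

Lemma rdotDl x y z : rdot (x + y) z = rdot x z + rdot y z.
Proof. by rewrite /rdot hdotDl ReD. Qed.
Lemma rdotDr x y z : rdot z (x + y) = rdot z x + rdot z y.
Proof. by rewrite /rdot hdotDr ReD. Qed.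
Lemma rdotNl x z : rdot (- x) z = - rdot x z.
Proof. by rewrite /rdot hdotNl ReN. Qed.
Lemma rdotNr x z : rdot z (- x) = - rdot z x.
Proof. by rewrite /rdot hdotNr ReN. Qed.
Lemma rdotZl t x z : rdot (t%:C%C *: x) z = t * rdot x z.
Proof. by rewrite /rdot hdotZl ReZ. Qed.
Lemma rdotZr t x z : rdot z (t%:C%C *: x) = t * rdot z x.
Proof. by rewrite rdotC rdotZl rdotC. Qed.

(** The imaginary part of the inner product is a real inner product against
['i *: y]; identities over [R[i]] thus follow from their real versions. *)
Lemma hdotE x y : '[x, y] = Complex (rdot x y) (rdot x ('i%C *: y)).
Proof.
rewrite /rdot hdotZr; case: '[_, _] => u v /=.
by rewrite mul0r sub0r mulNr opprK mul1r.
Qed.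

Lemma CauchySchwarz_rdot x y : `|rdot x y| <= hnorm x * hnorm y.
Proof.
have [->|y0] := eqVneq y 0; first by rewrite /rdot hdot0r hnorm0 mulr0 normr0.
have yp := hnorm_gt0 y0.
have := sqr_ge0 (hnorm (((hnorm y)^+2)%:C%C *: x - (rdot x y)%:C%C *: y)).
rewrite -[leRHS]rdotxx rdotDl !rdotDr !rdotNl !rdotNr !rdotZl !rdotZr !rdotxx.
rewrite (rdotC y x).
set s := rdot x y; set p := hnorm x; set q := hnorm y in yp *.
have -> : q ^+ 2 * (q ^+ 2 * p ^+ 2) - q ^+ 2 * (s * s)
    + (- (s * (q ^+ 2 * s)) - - (s * (s * q ^+ 2))) =
  q ^+ 2 * ((p * q) ^+ 2 - s ^+ 2) by ring.
rewrite pmulr_rge0 ?exprn_gt0// subr_ge0 -[s ^+ 2](real_normK (num_real s)).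
by rewrite ler_pXn2r// nnegrE ?mulr_ge0 ?hnorm_ge0.
Qed.

Lemma norm_cauchy_complete (u : nat -> H) (e : nat -> R) :
  (forall n m, (n <= m)%N -> hnorm (u n - u m) <= e n) ->
  (forall eps : R, 0 < eps -> exists n, e n < eps) ->
  exists l, forall n, hnorm (u n - l) <= e n.
Proof.
move=> ue e0.
have : cvg (u @ \oo).
  apply/cauchy_cvgP/cauchy_exP => eps.
  rewrite ltcE => /andP[/eqP /= im0 eps0].
  have [n en] := e0 _ eps0.
  exists (u n), n => // m /= nm; rewrite -ball_normE /= hnormE ltcE /=.
  by rewrite im0 eqxx (le_lt_trans (ue _ _ nm)).
move/cvg_ex => [l ul]; exists l => n; apply/ler_addgt0Pr => eps eps0.
move: ul => /cvgrPdist_lt /(_ eps%:C%C); rewrite ltcR => /(_ eps0) [m _ hm].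
have := hm (maxn n m) (leq_maxr _ _); rewrite /= hnormE ltcR (hnormB l) => hl.
have -> : u n - l = (u n - u (maxn n m)) + (u (maxn n m) - l) by rewrite addrA subrK.
rewrite (le_trans (hnormD _ _))// lerD// ?ue ?leq_maxl//.
exact: ltW.
Qed.

Definition approx (S : set (H * H)) x y :=
  forall eps : R, 0 < eps ->
    exists u v, [/\ S (u, v), hnorm (x - u) < eps & hnorm (y - v) < eps].

Definition approx_closed (S : set (H * H)) := forall x y, approx S x y -> S (x, y).

Lemma closed_approx (S : set (H * H)) : closed S -> approx_closed S.
Proof.
move=> cS x y xy; apply: cS => U [[U1 U2] /=].
move=> [/nbhs_normP [e1 /= + h1] /nbhs_normP [e2 /= + h2]] hU.
rewrite !ltcE => /andP[/eqP /= i1 r1] /andP[/eqP /= i2 r2].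
have m0 : 0 < Num.min (Re e1) (Re e2) by rewrite lt_min r1.
have [s [t [Sst]]] := xy _ m0; rewrite !lt_min => /andP[s1 _] /andP[_ t2].
exists (s, t); split => //; apply: hU; split => /=.
  by apply: h1; rewrite /ball_ /= hnormE ltcE /= i1 eqxx.
by apply: h2; rewrite /ball_ /= hnormE ltcE /= i2 eqxx.
Qed.

Lemma approx_dense (K : set H) :
  (forall x (eps : R), 0 < eps -> exists2 y, K y & hnorm (x - y) < eps) -> dense K.
Proof.
move=> h U [x Ux] oU; have /nbhs_normP [e /= e0 xe] := open_nbhs_nbhs (conj oU Ux).
move: e0; rewrite ltcE => /andP[/eqP /= i1 r1].
have [y Ky xy] := h x _ r1; exists y; split => //; apply: xe.
by rewrite /= hnormE ltcE /= i1 eqxx.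
Qed.

End Geometry.

(** * Orthogonal projection *)

Section Projection.
Context {R : realType} {H : hilbertType R}.
Implicit Types (x y z : H) (p q r : H * H) (t : R).

Definition subspace (V : lmodType R[i]) (S : set V) :=
  S 0 /\ forall (a : R[i]) u v, S u -> S v -> S (a *: u + v).

Lemma subspaceZ (V : lmodType R[i]) (S : set V) (a : R[i]) u :
  subspace S -> S u -> S (a *: u).
Proof. by move=> [h0 h] su; rewrite -[_ *: _]addr0; apply: h. Qed.

Lemma subspaceD (V : lmodType R[i]) (S : set V) u v :
  subspace S -> S u -> S v -> S (u + v).
Proof. by move=> [_ h] su sv; rewrite -[u]scale1r; apply: h. Qed.

(** The norm of the product [H * H] is the maximum norm, which does not come
from an inner product; this form restores the Hilbert sum of two copies. *)
Definition pdot p q : R := rdot p.1 q.1 + rdot p.2 q.2.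

Lemma pdotC p q : pdot p q = pdot q p.
Proof. by rewrite /pdot !(rdotC q.1) !(rdotC q.2). Qed.
Lemma pdotDl p q r : pdot (p + q) r = pdot p r + pdot q r.
Proof. by rewrite /pdot /= !rdotDl addrACA. Qed.
Lemma pdotZl t p r : pdot (t%:C%C *: p) r = t * pdot p r.
Proof. by rewrite /pdot /= !rdotZl mulrDr. Qed.
Lemma pdotNl p r : pdot (- p) r = - pdot p r.
Proof. by rewrite /pdot /= !rdotNl opprD. Qed.
Lemma pdotDr p q r : pdot r (p + q) = pdot r p + pdot r q.
Proof. by rewrite !(pdotC r) pdotDl. Qed.
Lemma pdotZr t p r : pdot r (t%:C%C *: p) = t * pdot r p.
Proof. by rewrite !(pdotC r) pdotZl. Qed.
Lemma pdotNr p r : pdot r (- p) = - pdot r p.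
Proof. by rewrite !(pdotC r) pdotNl. Qed.
Lemma pdot_ge0 p : 0 <= pdot p p.
Proof. by rewrite /pdot !rdotxx addr_ge0 ?sqr_ge0. Qed.

Lemma discriminant_le (h G Q : R) : 0 <= Q ->
  (forall t, 0 <= h - 2 * t * G + t ^+ 2 * Q) -> G ^+ 2 <= h * Q.
Proof.
rewrite le_eqVlt => /predU1P[<- hG|Q0 hG].
  have [->|G0] := eqVneq G 0; first by rewrite expr0n mulr0.
  have := hG ((h + 1) / (2 * G)).
  have -> : h - 2 * ((h + 1) / (2 * G)) * G + ((h + 1) / (2 * G)) ^+ 2 * 0 = -1.
    by field.
  by rewrite ler0N1.
have := hG (G / Q).
have -> : h - 2 * (G / Q) * G + (G / Q) ^+ 2 * Q = h - G ^+ 2 / Q.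
  by field; rewrite gt_eqF.
by rewrite subr_ge0 ler_pdivrMr.
Qed.

(** The points [u n] of [S] nearly minimize the distance to [p]. The
parallelogram identity makes them a Cauchy sequence; near minimality along the
line through [u n] directed by [s] makes [p - u n] nearly orthogonal to [s]. *)
Lemma minimizing_sequence (S : set (H * H)) p : subspace S ->
  exists u : nat -> H * H,
    [/\ forall n, S (u n),
        forall n m, (n <= m)%N ->
          pdot (u n - u m) (u n - u m) <= (n.+1%:R^-1) ^+ 2 &
        forall n s, S s -> pdot (p - u n) s ^+ 2 <= (n.+1%:R^-1) ^+ 2 * pdot s s].
Proof.
move=> sS; pose E := [set pdot (p - s) (p - s) | s in S].
have E0 : has_inf E.
  split; first by exists (pdot (p - 0) (p - 0)), 0 => //; case: sS.
  by exists 0 => _ [s _ <-]; exact: pdot_ge0.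
pose d := inf E.
have dle s : S s -> d <= pdot (p - s) (p - s).
  by move=> Ss; apply: ge_inf; [case: E0 | exists s].
have e0 n : 0 < (n.+1%:R^-1 : R) ^+ 2 / 4 by rewrite divr_gt0// exprn_gt0// invr_gt0.
have /choice [u hu] : forall n, exists v : H * H, S v /\
    pdot (p - v) (p - v) <= d + (n.+1%:R^-1) ^+ 2 / 4.
  move=> n; have [_ [s Ss <-] h] := inf_adherent (e0 n) E0.
  by exists s; split => //; apply: ltW.
exists u; split => [n|n m nm|n s Ss]; first by case: (hu n).
- have [Sn hn] := hu n; have [Sm hm] := hu m.
  (* The midpoint of [u n] and [u m] lies in [S]. *)
  have := dle _ (subspaceZ (2^-1)%:C%C sS (subspaceD sS Sn Sm)).
  have -> : u n - u m = (p - u m) - (p - u n) by rewrite [RHS]addrC opprB addrA subrK.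
  have -> : p - (2^-1)%:C%C *: (u n + u m) = (2^-1)%:C%C *: ((p - u m) + (p - u n)).
    rewrite -{1}[p]scale1r -{1}half_add_half scalerDl !scalerDr !scalerN opprD.
    by rewrite addrACA addrC.
  have mn : (m.+1%:R^-1 : R) ^+ 2 <= (n.+1%:R^-1) ^+ 2.
    by rewrite ler_pXn2r ?nnegrE ?invr_ge0// lef_pV2 ?posrE// ler_nat.
  move: hn hm mn; move: (p - u n) (p - u m) => v w.
  rewrite pdotZl pdotZr !pdotDl !pdotDr !pdotNl !pdotNr (pdotC v w).
  move: (pdot _ _) (pdot _ _) (pdot _ _) => P1 P2 P3.
  by move: (_ ^+ 2) (_ ^+ 2) => e1 e2; lra.
have [Sn hn] := hu n.
have : pdot (p - u n) s ^+ 2 <= ((n.+1%:R^-1) ^+ 2 / 4) * pdot s s.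
  apply: discriminant_le; first exact: pdot_ge0.
  move=> t; have := dle _ (subspaceD sS Sn (subspaceZ t%:C%C sS Ss)).
  rewrite opprD addrA; move: hn; move: (p - u n) => v.
  rewrite pdotDl !pdotDr !pdotNl !pdotNr !pdotZl !pdotZr (pdotC s v).
  move: (pdot _ _) (pdot _ _) (pdot _ _) => P1 P2 P3.
  move: (_ ^+ 2 / 4) => e1 h1 h2.
  have -> : t ^+ 2 * P1 = t * (t * P1) by ring.
  by lra.
move/le_trans; apply; rewrite ler_wpM2r ?pdot_ge0// ler_pdivrMr//.
by rewrite ler_peMr// ?sqr_ge0// ler1n.
Qed.

(** The foot [(x, y)] of the perpendicular is only a limit of points of [S], so
that the lemma serves both for closed and for dense subspaces. *)
Lemma projection (S : set (H * H)) a b : subspace S ->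
  exists x y, approx S x y /\
    forall s s', S (s, s') -> '[a - x, s] + '[b - y, s'] = 0.
Proof.
move=> sS; have [u [Su cu mu]] := minimizing_sequence (a, b) sS.
have epos n : 0 <= n.+1%:R^-1 :> R by rewrite invr_ge0.
have small (eps : R) : 0 < eps -> exists n, n.+1%:R^-1 < eps.
  by move=> /(inv_succ_small 1) [n hn]; exists n; rewrite -[ltLHS]mul1r.
have c1 n m : (n <= m)%N -> hnorm ((u n).1 - (u m).1) <= n.+1%:R^-1.
  move=> nm; rewrite -(@ler_pXn2r _ 2) ?nnegrE ?hnorm_ge0//.
  by apply: le_trans (cu _ _ nm); rewrite /pdot !rdotxx lerDl sqr_ge0.
have c2 n m : (n <= m)%N -> hnorm ((u n).2 - (u m).2) <= n.+1%:R^-1.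
  move=> nm; rewrite -(@ler_pXn2r _ 2) ?nnegrE ?hnorm_ge0//.
  by apply: le_trans (cu _ _ nm); rewrite /pdot !rdotxx lerDr sqr_ge0.
have [x hx] := norm_cauchy_complete c1 small.
have [y hy] := norm_cauchy_complete c2 small.
exists x, y; split.
  move=> eps /small [n ne]; exists (u n).1, (u n).2; split.
  - by case: (u n) (Su n).
  - by rewrite hnormB (le_lt_trans (hx n)).
  - by rewrite hnormB (le_lt_trans (hy n)).
have ortho s : S s -> pdot (a - x, b - y) s = 0.
  move=> Ss; apply/eqP; rewrite -normr_le0; apply/ler_addgt0Pr => eps e0.
  pose c := Num.sqrt (pdot s s) + hnorm s.1 + hnorm s.2 + 1.
  have c0 : 0 < c by rewrite ltr_wpDl// !addr_ge0 ?sqrtr_ge0 ?hnorm_ge0.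
  have [n ne] := small _ (divr_gt0 e0 c0).
  have -> : (a - x, b - y) = ((a, b) - u n) + (u n - (x, y)) by rewrite addrA subrK.
  rewrite pdotDl add0r; apply: le_trans (ltW (_ : n.+1%:R^-1 * c < eps)); last first.
    by rewrite -ltr_pdivlMr.
  rewrite (le_trans (ler_normD _ _))// /c !mulrDr -!addrA lerD//.
    rewrite -(@ler_pXn2r _ 2) ?nnegrE ?mulr_ge0 ?sqrtr_ge0//.
    by rewrite real_normK ?num_real// exprMn sqr_sqrtr ?pdot_ge0// mu.
  rewrite {1}/pdot /= addrA (le_trans (ler_normD _ _))// ler_wpDr ?mulr_ge0//.
  by rewrite lerD// (le_trans (CauchySchwarz_rdot _ _))// ler_wpM2r ?hnorm_ge0// ?hx ?hy.
move=> s s' Sst; have h1 := ortho _ Sst.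
have := ortho _ (subspaceZ 'i%C sS Sst); move: h1; rewrite /pdot /= => h1 h2.
by rewrite !hdotE; apply/eqP; rewrite eq_complex /= h1 h2 eqxx.
Qed.

Lemma dense_of_orthogonal0 (K : set H) : subspace K ->
  (forall h, (forall x, K x -> '[x, h] = 0) -> h = 0) ->
  forall b (eps : R), 0 < eps -> exists2 y, K y & hnorm (b - y) < eps.
Proof.
move=> sK K0 b eps e0.
have sS : subspace [set p : H * H | p.1 = 0 /\ K p.2].
  split; first by split => //; case: sK.
  move=> c [p1 p2] [q1 q2] /= [-> hp] [-> hq]; rewrite scaler0 addr0; split => //.
  by case: sK => _; apply.
have [x [y [xy o]]] := projection 0 b sS.
have : b - y = 0.
  apply: K0 => s Ks; rewrite hdotC.
  by have := o 0 s (conj erefl Ks); rewrite hdot0r add0r => ->; rewrite conjc0.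
move/eqP; rewrite subr_eq0 => /eqP ->.
by have [_ [t [[_ /= Kt] _ h]]] := xy _ e0; exists t.
Qed.

End Projection.

(** * Adjoints *)

Section Adjoint.
Context {R : realType} {H : hilbertType R}.
Implicit Types (x y z : H) (T : set (H * H)).

Lemma operator_subspace T : is_operator T -> subspace T.
Proof. by case=> T0 TD _; split. Qed.

(** Up to the flip [(u, v) |-> (- v, u)], the adjoint is the orthogonal
complement, so this is the identity of a closed subspace with its double
complement. *)
Lemma biadjoint T : subspace T -> approx_closed T ->
  adjoint (adjoint T) `<=` T.
Proof.
move=> sT cT [a b] /= ab.
have [x [y [xy o]]] := projection a b sT.
have Txy := cT _ _ xy.
have adj : adjoint T (b - y, - (a - x)).
  move=> s t /= Tst; apply/eqP; rewrite hdotNr -addr_eq0 addrC.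
  have /(congr1 conjc) := o _ _ Tst.
  by rewrite conjcD -!hdotC conjc0 => ->.
have h1 := ab _ _ adj; have h2 := adj _ _ Txy.
rewrite /= in h1 h2.
have : '[a - x, a - x] + '[b - y, b - y] = 0.
  have dB (p q r : H) : '[p, q - r] = '[p, q] - '[p, r] by rewrite hdotDr hdotNr.
  rewrite dB [X in _ + X]dB -h1 hdotNl (hdotC (b - y) y) h2 hdotNr conjcN -hdotC.
  by ring.
rewrite !hdotxx -rmorphD => /(congr1 (@complex.Re R)) /= /eqP.
rewrite paddr_eq0 ?sqr_ge0// !sqrf_eq0.
move=> /andP[/eqP/hnorm_eq0 /eqP + /eqP/hnorm_eq0 /eqP].
by rewrite !subr_eq0 => /eqP -> /eqP ->.
Qed.

Lemma adjoint_approx_closed T : approx_closed (adjoint T).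
Proof.
have rlim x y u v : (forall eps : R, 0 < eps -> exists u' v',
    [/\ rdot y u' = rdot x v', hnorm (u - u') < eps & hnorm (v - v') < eps]) ->
    rdot y u = rdot x v.
  move=> lim; apply/eqP; rewrite -subr_eq0 -normr_le0; apply/ler_addgt0Pr => eps e0.
  have c0 : 0 < hnorm x + hnorm y + 1 by rewrite ltr_wpDl ?addr_ge0 ?hnorm_ge0.
  have [u' [v' [e hu hv]]] := lim _ (divr_gt0 e0 c0).
  have -> : rdot y u - rdot x v = rdot y (u - u') - rdot x (v - v').
    by rewrite !rdotDr !rdotNr e; ring.
  rewrite add0r (le_trans (ler_normB _ _))//.
  rewrite (le_trans (lerD (CauchySchwarz_rdot _ _) (CauchySchwarz_rdot _ _)))//.
  move: hu hv; set d := eps / _ => hu hv.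
  have -> : eps = hnorm y * d + hnorm x * d + d.
    by rewrite /d; field; rewrite gt_eqF.
  rewrite -[leLHS]addr0 lerD ?(ltW (divr_gt0 e0 c0))//.
  by rewrite lerD// ler_wpM2l ?hnorm_ge0// ltW.
move=> u v uv x y Txy /=; rewrite !hdotE; congr Complex; apply: rlim => eps /uv.
  move=> [u' [v' [/(_ _ _ Txy) /= h hu hv]]]; exists u', v'; split => //.
  by rewrite /rdot h.
move=> [u' [v' [/(_ _ _ Txy) /= h hu hv]]]; exists ('i%C *: u'), ('i%C *: v').
by rewrite -!scalerBr !hnormZi /rdot !hdotZr h.
Qed.

Lemma selfadjoint_closed T : selfadjoint T -> approx_closed T.
Proof. by move=> [_ _ <-]; exact: adjoint_approx_closed. Qed.

Lemma selfadjoint_sym T x y x' y' : selfadjoint T ->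
  T (x, y) -> T (x', y') -> '[y, x'] = '[x, y'].
Proof. by move=> [_ _ sT] Txy; rewrite -[X in X (x', y')]sT => /(_ _ _ Txy). Qed.

Lemma adjoint_subspace T : subspace (adjoint T).
Proof.
split=> [x y _ /=|a [u v] [u' v'] h h' x y Txy /=]; first by rewrite !hdot0r.
by rewrite !hdotDr !hdotZr (h _ _ Txy) (h' _ _ Txy).
Qed.

(** If [h] is orthogonal to the domain of the adjoint, then [(0, h)] lies in the
double adjoint, hence in the graph of [T]. *)
Lemma adjoint_dense T : is_operator T -> approx_closed T ->
  forall b (eps : R), 0 < eps -> exists2 y, dom (adjoint T) y & hnorm (b - y) < eps.
Proof.
move=> oT cT; apply: dense_of_orthogonal0.
  have [a0 aD] := adjoint_subspace T.
  split; first by exists 0.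
  by move=> a u v [u' hu] [v' hv]; exists (a *: u' + v'); exact: aD hu hv.
move=> h hh; case: (oT) => T0 _ Tu; apply: (Tu 0) => //.
apply: biadjoint => //; first exact: operator_subspace.
by move=> x y xy /=; rewrite hdot0r hh//; exists y.
Qed.

End Adjoint.

(** * Closed graph theorem and resolvent sets *)

Section ClosedGraph.
Context {R : realType} {H : hilbertType R}.
Implicit Types (x y z : H) (T S : set (H * H)) (t : R) (mu : R[i]).

(** A gliding hump. If [W] were unbounded, there would be [w n] in [W] with
[hnorm (w n)] at least of order [n 3^n]. Moving from [u n] by [3^-n] in the
direction of [w n], with the sign that increases the absolute value of the
pairing with [w n], makes this value at least [3^-n hnorm (w n)]. All the later moves add
up to at most half of [3^-n], so they destroy at most half of it, and the limit
pairs unboundedly with [W]. *)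
Lemma weakly_bounded (W : set H) :
  (forall x, exists M : R, forall w, W w -> `|rdot x w| <= M) ->
  exists M : R, forall w, W w -> hnorm w <= M.
Proof.
move=> Wb; apply: contrapT => /forallNP nb.
have big (M : R) : exists w, W w /\ M < hnorm w.
  by have /existsNP [w /not_implyP [Ww /negP]] := nb M; rewrite -ltNge; exists w.
pose r n : R := (3^-1) ^+ n.
have r0 n : 0 < r n by rewrite exprn_gt0 ?invr_gt0.
have /choice [w hw] := fun n => big (2 * n%:R / r n).
pose step n x :=
  x + ((if 0 <= rdot x (w n) then 1 else -1) * (r n / hnorm (w n)))%:C%C *: w n.
pose fix u n := if n is m.+1 then step m (u m) else 0.
have w0 n : 0 < hnorm (w n).
  have [_] := hw n; apply: le_lt_trans.
  by rewrite divr_ge0 ?mulr_ge0// ltW.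
have du n : hnorm (u n.+1 - u n) = r n.
  rewrite /= /step addrAC subrr add0r hnormZr normrM.
  rewrite (_ : `|if _ then 1 else -1| = 1) ?mul1r.
    by rewrite ger0_norm ?divr_ge0 ?ltW// divfK// gt_eqF.
  by case: ifP; rewrite ?normrN ?normr1.
have lu n : r n * hnorm (w n) <= `|rdot (u n.+1) (w n)|.
  rewrite /= /step rdotDl rdotZl rdotxx.
  have -> (c : R) : c * (r n / hnorm (w n)) * hnorm (w n) ^+ 2 = c * (r n * hnorm (w n)).
    by field; exact: lt0r_neq0 (w0 n).
  have p0 : 0 < r n * hnorm (w n) by rewrite mulr_gt0.
  case: ifP => [h|/negbT]; first by rewrite mul1r ger0_norm ?lerDr ?addr_ge0 ?(ltW p0).
  rewrite -ltNge mulN1r => h; rewrite ltr0_norm; last by rewrite subr_lt0 (lt_trans h).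
  by rewrite opprB lerBrDr -subr_ge0 opprD addrA subrr sub0r oppr_ge0 ltW.
have r3 n : r n.+1 = r n / 3 by rewrite /r exprSr.
have cu n m : (n <= m)%N -> hnorm (u n - u m) <= 3 / 2 * (r n - r m).
  move=> /subnK <-; elim: (m - n)%N => [|k IH].
    by rewrite add0n !subrr hnorm0 mulr0.
  rewrite addSn; apply: (@le_trans _ _ (hnorm (u n - u (k + n)%N) + r (k + n)%N)).
    rewrite -du (hnormB (u _.+1)) (le_trans _ (hnormD _ _))//.
    by rewrite addrA subrK.
  by rewrite r3; move: IH; lra.
have cu' n m : (n <= m)%N -> hnorm (u n - u m) <= 3 / 2 * r n.
  move=> /cu /le_trans; apply; rewrite ler_pM2l ?lerBlDr ?lerDl; last lra.
  exact: ltW.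
have small (eps : R) : 0 < eps -> exists n, 3 / 2 * r n < eps.
  have rk n : r n * n.+1%:R <= 1.
    elim: n => [|n IH]; first by rewrite /r expr0 mul1r.
    have : 0 <= r n * n%:R by rewrite mulr_ge0 ?(ltW (r0 n)).
    move: IH; rewrite r3 -(addn2 n) -(addn1 n) !natrD.
    by move: (n%:R : R) (r n) => x b; lra.
  move=> /(inv_succ_small (3 / 2)) [n hn]; exists n; apply: le_lt_trans hn.
  have h32 : 0 < 3 / 2 :> R by lra.
  by rewrite (ler_pM2l h32) -[leRHS]mul1r ler_pdivlMr.
have [l hl] := norm_cauchy_complete cu' small.
have [M hM] := Wb l.
pose n := Num.truncn M.
have [Wn hn] := hw n.+1.
have := hM _ Wn; apply/negP; rewrite -ltNge.
have -> : l = u n.+2 - (u n.+2 - l) by rewrite opprB addrC subrK.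
rewrite rdotDl rdotNl; apply: lt_le_trans (lerB_normD _ _).
rewrite normrN.
apply: (@lt_le_trans _ _ (r n.+1 * hnorm (w n.+1) - 3 / 2 * r n.+2 * hnorm (w n.+1))).
  rewrite (r3 n.+1); move: hn; rewrite ltr_pdivrMr// => hn.
  have : M < n.+1%:R by exact: truncnS_gt.
  by move: hn; move: (r _) (hnorm _) (n.+1%:R : R) => b c k; lra.
rewrite lerB ?lu//.
by rewrite (le_trans (CauchySchwarz_rdot _ _))// ler_wpM2r ?hnorm_ge0.
Qed.

Lemma bounded_opP (f : H -> H) :
  bounded_op f <-> exists2 M : R, 0 < M & forall x, hnorm (f x) <= M * hnorm x.
Proof.
split=> [[M hM]|[M _ hM]]; last first.
  by exists M%:C%C => x; rewrite !hnormE -rmorphM lecR.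
exists (`|Re M| + 1); first by rewrite ltr_wpDl.
move=> x; have := hM x; rewrite !hnormE lecE => /andP[_]; rewrite mulrC ReZ /= mulrC.
move/le_trans; apply; rewrite ler_wpM2r ?hnorm_ge0// (le_trans (ler_norm _))//.
by rewrite lerDl.
Qed.

Lemma graph_operator (Q : {linear H -> H}) : is_operator (graph Q).
Proof.
split=> [|a [p1 p2] [q1 q2]|x y z]; rewrite /graph /= ?linear0//.
  by move=> -> ->; rewrite linearP.
by move=> -> ->.
Qed.

(** The adjoint maps the vectors of norm at most [1] of its domain to a weakly
bounded set, because the images pair with [x] to at most [hnorm (Q x)]. Hence the
adjoint is bounded, and so is [Q], the domain of the adjoint being dense. *)
Lemma closed_graph (Q : {linear H -> H}) : approx_closed (graph Q) -> bounded_op Q.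
Proof.
move=> cQ; pose A := adjoint (graph Q).
have [A0 AD] : subspace A := adjoint_subspace _.
have rA u v x : A (u, v) -> rdot x v = rdot (Q x) u.
  by move=> /(_ x (Q x) erefl) /= h; rewrite /rdot h.
have [x|M hM] := @weakly_bounded [set v | exists2 u, A (u, v) & hnorm u <= 1].
  exists (hnorm (Q x)) => v [u Auv u1]; rewrite (rA _ _ _ Auv).
  by rewrite (le_trans (CauchySchwarz_rdot _ _))// ler_piMr ?hnorm_ge0.
have M0 : 0 <= M by rewrite -(@hnorm0 _ H) hM//=; exists 0; rewrite ?hnorm0.
have bA u v x : A (u, v) -> rdot (Q x) u <= M * hnorm x * hnorm u.
  move=> Auv; have [->|u0] := eqVneq u 0; first by rewrite /rdot hdot0r hnorm0 mulr0.
  have nu := hnorm_gt0 u0.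
  have := hM (((hnorm u)^-1)%:C%C *: v); rewrite hnormZr ger0_norm ?invr_ge0 ?hnorm_ge0//.
  rewrite mulrC ler_pdivrMr// => hv.
  rewrite -(rA _ _ _ Auv) (le_trans (ler_norm _))// (le_trans (CauchySchwarz_rdot _ _))//.
  rewrite mulrAC [leRHS]mulrC ler_wpM2l ?hnorm_ge0// hv//.
  exists (((hnorm u)^-1)%:C%C *: u).
    by have := AD ((hnorm u)^-1)%:C%C _ _ Auv A0; rewrite !addr0.
  by rewrite hnormZr ger0_norm ?invr_ge0 ?hnorm_ge0// mulVf// gt_eqF.
(* Approximating [Q x] by [y] in the domain of the adjoint up to half its norm
   costs a factor at most [3 / 2] in [hnorm y] and a factor [2] in the final
   division. *)
exists (3 * M)%:C%C => x; rewrite !hnormE -rmorphM lecR.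
have [->|Q0] := eqVneq (Q x) 0; first by rewrite hnorm0 !mulr_ge0 ?hnorm_ge0.
have nq := hnorm_gt0 Q0.
have [y [v Ayv] hy] :=
  adjoint_dense (graph_operator Q) cQ (Q x) (divr_gt0 nq (ltr0Sn R 1)).
have ny : hnorm y <= 3 / 2 * hnorm (Q x).
  have := hnormD (Q x) (y - Q x); rewrite (hnormB y) addrC subrK.
  by move: hy; lra.
have h1 := bA _ _ x Ayv.
have h2 : rdot (Q x) (Q x - y) <= hnorm (Q x) * (hnorm (Q x) / 2).
  rewrite (le_trans (ler_norm _))// (le_trans (CauchySchwarz_rdot _ _))//.
  by rewrite ler_wpM2l ?hnorm_ge0 ?ltW.
have h3 : hnorm (Q x) ^+ 2 = rdot (Q x) y + rdot (Q x) (Q x - y).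
  by rewrite -rdotDr addrC subrK rdotxx.
have h4 : M * hnorm x * hnorm y <= M * hnorm x * (3 / 2 * hnorm (Q x)).
  by rewrite ler_wpM2l ?mulr_ge0 ?hnorm_ge0.
rewrite -(ler_pM2r nq).
move: h1 h2 h3 h4; rewrite expr2; move: (rdot _ _) (rdot _ _) => r1 r2.
by lra.
Qed.

Definition pack_linear (f : H -> H) (lf : linear f) : {linear H -> H} :=
  HB.pack f (GRing.isLinear.Build _ _ _ _ f lf).

Lemma bounded_inverse S : is_operator S -> approx_closed S ->
  (forall f, exists x, S (x, f)) -> (forall x, S (x, 0) -> x = 0) ->
  exists2 Q : {linear H -> H}, bounded_op Q & invop S = graph Q.
Proof.
move=> oS cS /choice [Q hQ] inj.
have [S0 SD Su] := oS.
have SQ x f : S (x, f) -> x = Q f.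
  move=> Sxf; apply/eqP; rewrite -subr_eq0; apply/eqP/inj.
  have := SD (-1) _ _ (hQ f) Sxf; congr (S _).
  by rewrite [LHS]surjective_pairing /= !scaleN1r addNr addrC.
have lQ : linear Q.
  by move=> a u v; apply/esym/SQ; exact: SD (hQ u) (hQ v).
have e : invop S = graph (pack_linear lQ).
  by apply/seteqP; split=> [[f x]|[f x]]; rewrite /invop /graph /=; [exact: SQ | move=> ->].
exists (pack_linear lQ) => //; apply: closed_graph; rewrite -e => f x fx.
apply: cS => eps /fx.
by move=> [u [v [h1 h2 h3]]]; exists v, u.
Qed.

Lemma shiftop_operator T mu : is_operator T -> is_operator (shiftop T mu).
Proof.
move=> [T0 TD Tu]; split.
- by exists 0 => //=; rewrite scaler0 subr0.
- move=> a [p1 p2] [q1 q2] [y /= Ty ->] [z /= Tz ->].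
  exists (a *: y + z) => /=; first exact: TD Ty Tz.
  by rewrite scalerBr scalerDr !scalerA mulrC opprD addrACA.
by move=> x y z [y' /= hy ->] [z' /= hz ->]; rewrite (Tu _ _ _ hy hz).
Qed.

Lemma shiftop_approx_closed T mu : approx_closed T -> approx_closed (shiftop T mu).
Proof.
move=> cT x y xy; exists (y + mu *: x) => /=; last by rewrite addrK.
apply: cT => eps e0; pose m := Re `|mu|.
have m0 : 0 <= m by rewrite /m normc_def /= sqrtr_ge0.
have d0 : 0 < eps / (m + 1) by rewrite divr_gt0// ltr_wpDl.
have [u [v [[w /= Tuw ->] h1 h2]]] := xy _ d0.
have e1 : eps = m * (eps / (m + 1)) + eps / (m + 1).
  by field; rewrite gt_eqF// ltr_wpDl.
exists u, w; split => //.
  by rewrite (lt_le_trans h1)// [leRHS]e1 lerDr mulr_ge0// ltW.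
have -> : y + mu *: x - w = mu *: (x - u) + (y - (w - mu *: u)).
  by rewrite scalerBr opprB addrCA [X in _ = _ + X]addrA subrK addrA.
rewrite (le_lt_trans (hnormD _ _))// [ltRHS]e1 ler_ltD//.
by rewrite hnormZ ler_wpM2l// ltW.
Qed.

(** By the closed graph theorem, boundedness of the inverse is automatic. *)
Lemma resolventP T mu : is_operator T -> approx_closed T ->
  resolvent_set T mu <->
  (forall f, exists x, T (x, f + mu *: x)) /\
  (forall x, T (x, mu *: x) -> x = 0).
Proof.
move=> oT cT; split=> [[Q bQ e]|[sur inj]].
  have hQ x f : shiftop T mu (x, f) <-> x = Q f.
    by have := congr1 (fun P => P (f, x)) e; rewrite /invop /graph /= => ->.
  split=> [f|x Tx].
    have /hQ [y /= Ty ->] : Q f = Q f by [].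
    by exists (Q f); rewrite subrK.
  suff /hQ : shiftop T mu (x, 0) by rewrite linear0.
  by exists (mu *: x) => //=; rewrite subrr.
apply: bounded_inverse; [exact: shiftop_operator|exact: shiftop_approx_closed| |].
  by move=> f; have [x Tx] := sur f; exists x, (f + mu *: x) => //=; rewrite addrK.
move=> x [y /= Ty /eqP]; rewrite eq_sym subr_eq0 => /eqP yE; apply: inj.
by rewrite -yE.
Qed.

End ClosedGraph.

(** * Square roots of bounded nonnegative operators *)

Section SquareRoot.
Context {R : realType} {H : hilbertType R}.
Implicit Types (x y z : H) (t : R) (A Q : {linear H -> H}).

Lemma bounded_nonneg_sym A x y : bounded_nonneg A -> '[A x, y] = '[x, A y].
Proof. by move=> [_ sA _]; exact: (selfadjoint_sym sA). Qed.

Lemma bounded_nonneg_rdot A :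
  bounded_op A -> (forall x y, rdot (A x) y = rdot x (A y)) ->
  (forall x, 0 <= rdot (A x) x) -> bounded_nonneg A.
Proof.
move=> bA rA pA.
have sA x y : '[A x, y] = '[x, A y] by rewrite !hdotE rA -linearZ rA.
split => //; last first.
  move=> x y; rewrite /graph /= => ->; rewrite lecE pA andbT /= eq_sym.
  have : '[A x, x] = conjc '[A x, x] by rewrite {1}sA hdotC.
  by case: '[_, _] => u v /= [] /eqP; rewrite -addr_eq0 -mulr2n mulrn_eq0 => /eqP ->.
split; [exact: graph_operator| |].
  by apply: approx_dense => x e e0; exists x; [exists (A x) | rewrite subrr hnorm0].
apply/seteqP; split=> [[u v] h|[u v]]; rewrite /adjoint /graph /=; last first.
  by move=> -> x y ->; exact: sA.
apply/eqP; rewrite -subr_eq0; apply/eqP/hdotxx_eq0.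
have e z : '[z, v - A u] = 0.
  by rewrite hdotDr hdotNr -(h _ _ erefl : '[A z, u] = '[z, v]) sA subrr.
exact: e.
Qed.

(** Iterates towards a solution of [2 Y = B + Y^2], for which [I - Y] is a square
root of [I - B]. *)
Fixpoint sqrt_iter (B : {linear H -> H}) n x {struct n} : H :=
  if n is m.+1 then (2^-1)%:C%C *: (B x + sqrt_iter B m (sqrt_iter B m x)) else 0.

(** The same iteration for the scalar [1] in place of [B]: the iterates of a
contraction are dominated by it, and so are their increments. *)
Fixpoint sqrt_bound n : R :=
  if n is m.+1 then (1 + sqrt_bound m ^+ 2) / 2 else 0.

Lemma sqrt_bound_ge0 n : 0 <= sqrt_bound n.
Proof. by case: n => //= n; rewrite divr_ge0 ?addr_ge0 ?sqr_ge0. Qed.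

Lemma sqrt_bound_le1 n : sqrt_bound n <= 1.
Proof.
elim: n => //= n IH; rewrite ler_pdivrMr// mul1r (_ : 2 = 1 + 1)// lerD2l.
by rewrite expr_le1 ?sqrt_bound_ge0.
Qed.

Lemma sqrt_bound_le_succ n : sqrt_bound n <= sqrt_bound n.+1.
Proof. by rewrite /=; have := sqr_ge0 (1 - sqrt_bound n); lra. Qed.

Lemma hnorm_half z : hnorm ((2^-1)%:C%C *: z) = hnorm z / 2.
Proof. by rewrite hnormZr ger0_norm ?invr_ge0// mulrC. Qed.

Section Iteration.
Variable B : {linear H -> H}.
Hypothesis B_contr : forall x, hnorm (B x) <= hnorm x.
Hypothesis B_sym : forall x y, rdot (B x) y = rdot x (B y).
Local Notation Y := (sqrt_iter B).
Local Notation a := sqrt_bound.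

Lemma sqrt_iter_linear n : linear (Y n).
Proof.
elim: n => [|n IH] c u v /=; first by rewrite scaler0 addr0.
rewrite linearP !IH addrACA -scalerDr.
rewrite [LHS]scalerDr; congr (_ + _).
by rewrite !scalerA mulrC.
Qed.

Lemma sqrt_iterB n u v : Y n (u - v) = Y n u - Y n v.
Proof. by rewrite addrC -scaleN1r sqrt_iter_linear scaleN1r addrC. Qed.

Lemma sqrt_iter_le n x : hnorm (Y n x) <= a n * hnorm x.
Proof.
elim: n x => [|n IH] x /=; first by rewrite hnorm0 mul0r.
rewrite hnorm_half; have := hnormD (B x) (Y n (Y n x)); have := B_contr x.
have := IH (Y n x); have := ler_wpM2l (sqrt_bound_ge0 n) (IH x).
by rewrite mulrA -expr2; lra.
Qed.

(** Since [Y^2 - Z^2 = Y (Y - Z) + (Y - Z) Z], increments obey the recursion of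
the increments of the scalar sequence, commuting or not. *)
Lemma sqrt_iter_step n x : hnorm (Y n x - Y n.+1 x) <= (a n.+1 - a n) * hnorm x.
Proof.
elim: n x => [|n IH] x.
  by rewrite /= sub0r hnormN addr0 hnorm_half expr0n /=; have := B_contr x; lra.
have -> : Y n.+1 x - Y n.+2 x = (2^-1)%:C%C *:
    (Y n (Y n x - Y n.+1 x) + (Y n (Y n.+1 x) - Y n.+1 (Y n.+1 x))).
  rewrite sqrt_iterB addrA subrK -[Y n.+2 x]/(_ *: (B x + Y n.+1 (Y n.+1 x))).
  rewrite -[Y n.+1 x in LHS]/(_ *: (B x + Y n (Y n x))) -scalerBr opprD addrACA.
  by rewrite subrr add0r.
rewrite hnorm_half.
set p := Y n _; set q := _ - _.
have h1 : hnorm p <= a n * ((a n.+1 - a n) * hnorm x).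
  by rewrite (le_trans (sqrt_iter_le _ _))// ler_wpM2l ?sqrt_bound_ge0.
have h2 : hnorm q <= (a n.+1 - a n) * (a n.+1 * hnorm x).
  rewrite (le_trans (IH _))// ler_wpM2l ?subr_ge0 ?sqrt_bound_le_succ//.
  exact: sqrt_iter_le.
have -> : (a n.+2 - a n.+1) * hnorm x =
    (a n * ((a n.+1 - a n) * hnorm x) + (a n.+1 - a n) * (a n.+1 * hnorm x)) / 2.
  rewrite -[a n.+2]/((1 + a n.+1 ^+ 2) / 2).
  by rewrite -[X in (_ - X) * _]/((1 + a n ^+ 2) / 2); field.
by rewrite ler_wpM2r ?invr_ge0// (le_trans (hnormD _ _))// lerD.
Qed.

Lemma sqrt_iter_cauchy n m x :
  (n <= m)%N -> hnorm (Y n x - Y m x) <= (a m - a n) * hnorm x.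
Proof.
move=> /subnK <-; elim: (m - n)%N => [|k IH].
  by rewrite add0n !subrr hnorm0 mul0r.
rewrite addSn; have := hnormD (Y n x - Y (k + n)%N x) (Y (k + n)%N x - Y (k + n).+1 x).
rewrite addrA subrK => /le_trans; apply.
apply: (le_trans (lerD IH (sqrt_iter_step _ _))).
by rewrite -mulrDl addrC addrA subrK.
Qed.

Lemma sqrt_iter_sym n x y : rdot (Y n x) y = rdot x (Y n y).
Proof.
elim: n x y => [|n IH] x y /=; first by rewrite /rdot hdot0l hdot0r.
by rewrite rdotZl rdotZr rdotDl rdotDr B_sym !IH.
Qed.

(** Each property of the limit [Z] of the iterates is obtained by bounding a
defect by a multiple of [L - a n], which tends to [0]. *)
Lemma sqrt_contraction : exists Q, bounded_nonneg Q /\ forall x, Q (Q x) = x - B x.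
Proof.
pose E := range a; pose L := sup E.
have sE : has_sup E.
  by split; [exists (a 0%N), 0%N | exists 1 => _ [n _ <-]; exact: sqrt_bound_le1].
have aL n : a n <= L by apply: ub_le_sup; [case: sE | exists n].
have L1 : L <= 1.
  by apply: ge_sup; [case: sE | move=> _ [n _ <-]; exact: sqrt_bound_le1].
have small (c eps : R) : 0 <= c -> 0 < eps -> exists n, (L - a n) * c < eps.
  move=> c0 e0; have c1 : 0 < c + 1 by rewrite ltr_wpDl.
  have [_ [n _ <-] hn] := sup_adherent (divr_gt0 e0 c1) sE.
  exists n; apply: (@le_lt_trans _ _ ((L - a n) * (c + 1))).
    by rewrite ler_wpM2l ?subr_ge0// lerDl.
  by rewrite -ltr_pdivlMr// ltrBlDr -ltrBlDl.
have lim0 (c r : R) : 0 <= c -> (forall n, r <= (L - a n) * c) -> r <= 0.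
  move=> c0 hr; apply/ler_addgt0Pr => eps e0; rewrite add0r.
  by have [n /ltW] := small _ _ c0 e0; apply: le_trans.
have vlim0 (c : R) z : 0 <= c -> (forall n, hnorm z <= (L - a n) * c) -> z = 0.
  move=> c0 /(lim0 _ _ c0) z0; apply: hnorm_eq0.
  by apply/eqP; rewrite eq_le z0 hnorm_ge0.
have ex x : exists l, forall n, hnorm (Y n x - l) <= (L - a n) * hnorm x.
  apply: norm_cauchy_complete; last by move=> eps e0; apply: small; rewrite ?hnorm_ge0.
  move=> n m nm; apply: (le_trans (sqrt_iter_cauchy _ nm)).
  by rewrite ler_wpM2r ?hnorm_ge0// lerB.
have [Z hZ] := choice ex.
have lZ : linear Z.
  move=> c u v; apply/eqP; rewrite -subr_eq0; apply/eqP.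
  set k := Re `|c|.
  have k0 : 0 <= k by rewrite /k normc_def /= sqrtr_ge0.
  apply: (vlim0 (hnorm (c *: u + v) + k * hnorm u + hnorm v)).
    by rewrite !addr_ge0 ?mulr_ge0 ?hnorm_ge0.
  move=> n; have -> : Z (c *: u + v) - (c *: Z u + Z v) =
      - (Y n (c *: u + v) - Z (c *: u + v)) + (c *: (Y n u - Z u) + (Y n v - Z v)).
    rewrite sqrt_iter_linear opprB scalerBr [X in _ = _ + X]addrACA -opprD.
    by rewrite [RHS]addrA subrK.
  rewrite (le_trans (hnormD _ _))// hnormN.
  apply: (le_trans (lerD (hZ _ _) (le_trans (hnormD _ _) (lerD (lexx _) (hZ _ _))))).
  rewrite hnormZ -/k; have := ler_wpM2l k0 (hZ u n).
  by rewrite !mulrDr; lra.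
have ZZ x : Z (Z x) = Z x + Z x - B x.
  apply/eqP; rewrite -subr_eq0; apply/eqP.
  apply: (vlim0 (3 * hnorm x + hnorm (Z x))).
    by rewrite !addr_ge0 ?mulr_ge0 ?hnorm_ge0.
  move=> n; have -> : Z (Z x) - (Z x + Z x - B x) =
     (Y n.+1 x - Z x) + (Y n.+1 x - Z x) - (Y n (Y n x - Z x) + (Y n (Z x) - Z (Z x))).
    have e : Y n.+1 x + Y n.+1 x = B x + Y n (Y n x).
      by rewrite /= -scalerDl half_add_half scale1r.
    rewrite sqrt_iterB [X in _ = _ - X]addrA subrK [X in _ = X - _]addrACA e.
    by rewrite -opprD !opprB [X in _ = X + _]addrAC [RHS]addrCA addrK.
  rewrite (le_trans (hnormD _ _))// hnormN.
  have h1 := hZ x n.+1; have h2 := hZ x n; have h3 := hZ (Z x) n.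
  have h4 := hnormD (Y n.+1 x - Z x) (Y n.+1 x - Z x).
  have h5 := hnormD (Y n (Y n x - Z x)) (Y n (Z x) - Z (Z x)).
  have h6 := sqrt_iter_le n (Y n x - Z x).
  have h7 : a n * hnorm (Y n x - Z x) <= hnorm (Y n x - Z x).
    by rewrite ler_piMl ?hnorm_ge0 ?sqrt_bound_le1.
  have h8 : (L - a n.+1) * hnorm x <= (L - a n) * hnorm x.
    by rewrite ler_wpM2r ?hnorm_ge0// lerB ?sqrt_bound_le_succ.
  by rewrite mulrDr; move: h1 h4 h8; move: (a n.+1) (Y n.+1 x) => *; lra.
have bZ x : hnorm (Z x) <= hnorm x.
  have h1 := hZ x 0%N; rewrite /= sub0r hnormN subr0 in h1.
  by rewrite (le_trans h1)// ler_piMl ?hnorm_ge0.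
have ZS x y : rdot (Z x) y = rdot x (Z y).
  apply/eqP; rewrite -subr_eq0 -normr_le0; apply: (lim0 (2 * (hnorm x * hnorm y))).
    by rewrite !mulr_ge0 ?hnorm_ge0.
  move=> n; have -> : rdot (Z x) y - rdot x (Z y) =
      rdot x (Y n y - Z y) - rdot (Y n x - Z x) y.
    by rewrite !rdotDl !rdotDr rdotNl rdotNr sqrt_iter_sym; ring.
  rewrite (le_trans (ler_normB _ _))//.
  apply: (le_trans (lerD (CauchySchwarz_rdot _ _) (CauchySchwarz_rdot _ _))).
  have := ler_wpM2l (hnorm_ge0 x) (hZ y n); have := ler_wpM2r (hnorm_ge0 y) (hZ x n).
  by lra.
have lQ : linear (fun x => x - Z x).
  by move=> c u v; rewrite lZ scalerBr opprD addrACA.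
exists (pack_linear lQ); split=> /=.
  apply: bounded_nonneg_rdot => /=.
  - apply/bounded_opP; exists 2 => // x.
    by have := hnormD x (- Z x); have := bZ x; rewrite hnormN; lra.
  - by move=> x y; rewrite rdotDl rdotDr rdotNl rdotNr ZS.
  move=> x; rewrite rdotDl rdotNl rdotxx subr_ge0 (le_trans (ler_norm _))//.
  by rewrite (le_trans (CauchySchwarz_rdot _ _))// expr2 ler_wpM2r ?hnorm_ge0.
move=> x; have ZB u v : Z (u - v) = Z u - Z v.
  by rewrite addrC -scaleN1r lZ scaleN1r addrC.
by rewrite ZB ZZ opprB [X in _ + X]addrAC addrK addrA subrK.
Qed.

End Iteration.

(** If [A1] is [A] rescaled to a contraction, then [I - A1] is a contraction
too: nonnegativity of [A1] at [x - A1 x] bounds the square of [hnorm (A1 x)] by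
[rdot (A1 x) x]. *)
Lemma sqrt_exists A : bounded_nonneg A -> exists Q, is_sqrt A Q.
Proof.
move=> hA; have [bA sA pA] := hA; have [M M0 hM] := (bounded_opP A).1 bA.
have lA : linear (fun x => (M^-1)%:C%C *: A x).
  by move=> c u v; rewrite linearP scalerDr !scalerA mulrC.
pose A1 := pack_linear lA.
have rA1 x y : rdot (A1 x) y = rdot x (A1 y).
  by rewrite /A1 /= rdotZl rdotZr /rdot (bounded_nonneg_sym _ _ hA).
have pA1 x : 0 <= rdot (A1 x) x.
  rewrite /A1 /= rdotZl mulr_ge0 ?invr_ge0 ?(ltW M0)//.
  by have := pA x (A x) erefl; rewrite lecE => /andP[].
have bA1 x : hnorm (A1 x) <= hnorm x.
  rewrite /A1 /= hnormZr ger0_norm ?invr_ge0 ?(ltW M0)//.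
  by rewrite mulrC ler_pdivrMr// mulrC.
have lB : linear (fun x => x - A1 x).
  by move=> c u v; rewrite linearP scalerBr opprD addrACA.
have [|x y|Q [hQ QQ]] := @sqrt_contraction (pack_linear lB).
- move=> x /=; rewrite -(@ler_pXn2r _ 2) ?nnegrE ?hnorm_ge0//.
  have h1 := pA1 (x - A1 x).
  have h2 : rdot (A1 (A1 x)) (A1 x) <= hnorm (A1 x) ^+ 2.
    rewrite (le_trans (ler_norm _))// (le_trans (CauchySchwarz_rdot _ _))// expr2.
    by rewrite ler_wpM2r ?hnorm_ge0.
  have h3 : 0 <= hnorm (A1 x) ^+ 2 by rewrite sqr_ge0.
  rewrite -!rdotxx in h2 h3 *; move: h1.
  rewrite linearB /= !rdotDl !rdotDr !rdotNl !rdotNr (rdotC x) (rA1 (A1 x) x).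
  by rewrite /A1 /= in h2 h3 *; lra.
- by rewrite /= rdotDl rdotDr rdotNl rdotNr rA1.
have lQ : linear (fun x => (Num.sqrt M)%:C%C *: Q x).
  by move=> c u v; rewrite linearP scalerDr !scalerA mulrC.
have [bQ sQ pQ] := hQ; have [N N0 hN] := (bounded_opP Q).1 bQ.
exists (pack_linear lQ); split.
  apply: bounded_nonneg_rdot.
  - apply/bounded_opP; exists (Num.sqrt M * N); first by rewrite mulr_gt0 ?sqrtr_gt0.
    by move=> x /=; rewrite hnormZr ger0_norm ?sqrtr_ge0// -mulrA ler_wpM2l ?sqrtr_ge0.
  - by move=> x y /=; rewrite rdotZl rdotZr /rdot (bounded_nonneg_sym _ _ hQ).
  move=> x /=; rewrite rdotZl mulr_ge0 ?sqrtr_ge0//.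
  by have := pQ x (Q x) erefl; rewrite lecE => /andP[].
move=> x /=; rewrite linearZ /= QQ /= opprB addrC subrK !scalerA.
rewrite -!rmorphM -expr2 sqr_sqrtr ?(ltW M0)// mulfV ?gt_eqF//.
by rewrite (rmorph1 (real_complex R)) scale1r.
Qed.

Lemma sqrtopP A : bounded_nonneg A -> is_sqrt A (sqrtop A).
Proof.
by move=> /sqrt_exists h; rewrite /sqrtop; case: pselect => // e; case: cid.
Qed.

End SquareRoot.

(** * Spectrum of a nonnegative self-adjoint operator *)

Section NonnegativeSelfadjoint.
Context {R : realType} {H : hilbertType R}.
Implicit Types (x y z : H) (C : set (H * H)) (mu : R[i]).

Lemma nonneg_eigenvalue C mu x : nonneg C -> C (x, mu *: x) -> ~ (0 <= mu) -> x = 0.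
Proof.
move=> pC /pC; rewrite hdotZl hdotxx => h nmu.
have [//|x0] := eqVneq x 0; exfalso; apply: nmu.
rewrite pmulr_lge0// in h.
by rewrite ltcR exprn_gt0// hnorm_gt0.
Qed.

(** The pairing of [y - mu x] with [x] is [r - mu (hnorm x)^2] for some [r >= 0],
so [d] can be the absolute value of the imaginary part of [mu], or [- Re mu] if
[mu] is real. *)
Lemma nonneg_bounded_below C mu : nonneg C -> ~ (0 <= mu) ->
  exists2 d : R, 0 < d & forall x y, C (x, y) -> d * hnorm x <= hnorm (y - mu *: x).
Proof.
case: mu => a b pC nmu.
have key (d : R) z x : d * hnorm x ^+ 2 <= hnorm z * hnorm x -> d * hnorm x <= hnorm z.
  have := hnorm_ge0 x; rewrite le_eqVlt => /predU1P[<- _|x0].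
    by rewrite mulr0 hnorm_ge0.
  by rewrite expr2 mulrA ler_pM2r.
have comp x y : C (x, y) -> exists2 r : R, 0 <= r &
    '[y - Complex a b *: x, x] = Complex (r - a * hnorm x ^+ 2) (- (b * hnorm x ^+ 2)).
  move=> /pC; rewrite lecE => /andP[/eqP /= i0 r0]; exists (Re '[y, x]) => //.
  rewrite hdotDl hdotNl hdotZl hdotxx; move: i0; case: '[y, x] => u v /= ->.
  by apply/eqP; rewrite eq_complex /= !(mulr0, subr0, add0r, sub0r) !eqxx.
have [b0|b0] := eqVneq b 0; last first.
  exists `|b|; first by rewrite normr_gt0.
  move=> x y Cxy; apply: key; have [r _] := comp _ _ Cxy.
  rewrite hdotE => -[_ e].
  have := CauchySchwarz_rdot (y - Complex a b *: x) ('i%C *: x).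
  by rewrite e normrN normrM [`|_ ^+ 2|]ger0_norm ?sqr_ge0// hnormZi.
have a0 : a < 0.
  rewrite ltNge; apply/negP => a0; apply: nmu.
  by rewrite b0 lecE /= eqxx.
exists (- a); first by rewrite oppr_gt0.
move=> x y Cxy; apply: key; have [r r0] := comp _ _ Cxy.
rewrite hdotE => -[e _].
have := CauchySchwarz_rdot (y - Complex a b *: x) x.
by rewrite e => /(le_trans (ler_norm _)); lra.
Qed.

(** A vector orthogonal to the range of [C - mu] is an eigenvector of [C] for the
conjugate of [mu], so the range is dense; the lower bound turns approximate
solutions into a Cauchy sequence, whose limit is a solution since [C] is
closed. *)
Lemma nonneg_selfadjoint_resolvent C mu : selfadjoint C -> nonneg C ->
  ~ (0 <= mu) -> resolvent_set C mu.
Proof.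
move=> sC pC nmu; have [oC _ aC] := sC; have cC := selfadjoint_closed sC.
apply/(resolventP _ oC cC); split; last by move=> x Cx; exact: nonneg_eigenvalue Cx nmu.
pose K := [set f | exists x, shiftop C mu (x, f)].
have [S0 SD _] := shiftop_operator mu oC.
have sK : subspace K.
  split; first by exists 0.
  by move=> a u v [x hx] [y hy]; exists (a *: x + y); exact: SD hx hy.
have K0 h : (forall f, K f -> '[f, h] = 0) -> h = 0.
  move=> hK; apply: (@nonneg_eigenvalue C (conjc mu)) => //; last by rewrite conj_ge0.
  rewrite -[X in X (_, _)]aC => x y Cxy /=; rewrite hdotZr conjcK.
  apply/eqP; rewrite -subr_eq0 -hdotZl -hdotNl -hdotDl; apply/eqP/hK.
  by exists x, y.
have [d d0 hd] := nonneg_bounded_below pC nmu.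
have hd' x f : shiftop C mu (x, f) -> d * hnorm x <= hnorm f.
  by move=> [y /= Cxy ->]; exact: hd.
move=> f.
have pos n : 0 < n.+1%:R^-1 :> R by rewrite invr_gt0.
have /choice [u hu] : forall n, exists p : H * H,
    shiftop C mu p /\ hnorm (f - p.2) < n.+1%:R^-1.
  move=> n; have [g [x Sxg] hg] := dense_of_orthogonal0 sK K0 f (pos n).
  by exists (x, g).
have [n m nm|eps e0|x hx] :=
    @norm_cauchy_complete _ _ (fun n => (u n).1) (fun n => 2 / d * n.+1%:R^-1).
- have [Sn hn] := hu n; have [Sm hm] := hu m.
  have := SD (-1) _ _ Sm Sn.
  have -> : -1 *: u m + u n = ((u n).1 - (u m).1, (u n).2 - (u m).2).
    by rewrite [LHS]surjective_pairing /= !scaleN1r !(addrC (- _)).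
  move=> /hd' h; rewrite [leRHS]mulrAC ler_pdivlMr// (mulrC _ d) (le_trans h)//.
  have -> : (u n).2 - (u m).2 = (f - (u m).2) - (f - (u n).2).
    by rewrite [RHS]addrC opprB addrA subrK.
  rewrite (le_trans (hnormD _ _))// hnormN.
  have : (m.+1%:R^-1 : R) <= n.+1%:R^-1 by rewrite lef_pV2 ?posrE// ler_nat.
  move: hn hm; move: (n.+1%:R^-1 : R) (m.+1%:R^-1 : R) => a b.
  by lra.
- exact: inv_succ_small.
have : shiftop C mu (x, f).
  apply: shiftop_approx_closed => // eps e0.
  have [n hn] := inv_succ_small (2 / d + 1) e0; exists (u n).1, (u n).2.
  have [Sn fn] := hu n; have := pos n.
  have xn : hnorm ((u n).1 - x) <= 2 / d * n.+1%:R^-1 := hx n.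
  have : 0 < 2 / d * n.+1%:R^-1 by rewrite mulr_gt0// divr_gt0.
  move: hn xn fn; rewrite mulrDl mul1r.
  move: (2 / d * n.+1%:R^-1) (n.+1%:R^-1 : R) => q r qr xn fn q0 r0; split.
  - by case: (u n) Sn.
  - by rewrite hnormB; lra.
  by lra.
by move=> [y /= Cxy ->]; exists x; rewrite subrK.
Qed.

End NonnegativeSelfadjoint.

(** * The products [A B] and [S B S] *)

Section Products.
Context {R : realType} {H : hilbertType R}.
Variables (A S : {linear H -> H}) (B : set (H * H)).
Hypotheses (S_sym : forall x y, '[S x, y] = '[x, S y]) (SS : forall x, S (S x) = A x).
Hypotheses (B_sa : selfadjoint B) (B_nonneg : nonneg B).
Let T := mulop (graph A) B.
Let C := mulop (graph S) (mulop B (graph S)).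
Hypothesis T_closed : approx_closed T.
Implicit Types (x y z u v b : H) (mu nu : R[i]).

Lemma leftprodP x y : T (x, y) <-> exists2 b, B (x, b) & y = A b.
Proof. by split=> -[b]; exists b. Qed.

Lemma sandwichP x y : C (x, y) <-> exists2 b, B (S x, b) & y = S b.
Proof.
split=> [[b [z /= zE Bzb] yE]|[b Bxb yE]]; first by exists b => //; rewrite -zE.
by exists b => //; exists (S x).
Qed.

Let A_sym x y : '[A x, y] = '[x, A y].
Proof. by rewrite -!SS !S_sym. Qed.

Let B_op : is_operator B. Proof. by case: B_sa. Qed.

Let B0 : B (0, 0). Proof. by case: B_op. Qed.

Let BD a x y x' y' : B (x, y) -> B (x', y') -> B (a *: x + x', a *: y + y').
Proof. by case: B_op => _ BD _; exact: BD. Qed.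

Let BZ a x y : B (x, y) -> B (a *: x, a *: y).
Proof. by move=> h; have := BD a h B0; rewrite !addr0. Qed.

Let B_fun x y z : B (x, y) -> B (x, z) -> y = z.
Proof. by case: B_op => _ _; apply. Qed.

Lemma leftprod_operator : is_operator T.
Proof.
split; first by apply/leftprodP; exists 0; rewrite ?linear0.
  move=> a [x y] [x' y'] /leftprodP[b hb ->] /leftprodP[b' hb' ->]; apply/leftprodP.
  by exists (a *: b + b'); [exact: BD | rewrite linearP].
by move=> x y z /leftprodP[b hb ->] /leftprodP[b' hb' ->]; rewrite (B_fun hb hb').
Qed.

Lemma sandwich_operator : is_operator C.
Proof.
split; first by apply/sandwichP; exists 0; rewrite ?linear0.
  move=> a [x y] [x' y'] /sandwichP[b hb ->] /sandwichP[b' hb' ->]; apply/sandwichP.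
  by exists (a *: b + b'); rewrite linearP //; exact: BD.
by move=> x y z /sandwichP[b hb ->] /sandwichP[b' hb' ->]; rewrite (B_fun hb hb').
Qed.

Lemma adjoint_leftprod u v : adjoint T (u, v) -> B (A u, v).
Proof.
move=> h; have [_ _ <-] := B_sa => x b Bxb /=.
by rewrite -A_sym; apply: h; apply/leftprodP; exists b.
Qed.

(** Being closed, [A B] contains the adjoint of its own adjoint, hence also that
of [B A], which contains this adjoint. *)
Lemma leftprod_of_adjoint x y :
  (forall w v, B (A w, v) -> '[v, x] = '[w, y]) -> T (x, y).
Proof.
move=> h; apply: biadjoint => //; first exact: operator_subspace leftprod_operator.
by move=> w v /adjoint_leftprod /h.
Qed.

(** The domain of [C] contains both the kernel of [S] and the image under [S] of
the domain of [B A]; a vector orthogonal to the latter is in the former. *)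
Lemma sandwich_dom_dense : dense (dom C).
Proof.
apply/approx_dense/dense_of_orthogonal0.
  have [C0 CD _] := sandwich_operator; split; first by exists 0.
  by move=> a u v [u' hu] [v' hv]; exists (a *: u' + v'); exact: CD hu hv.
move=> h hC.
have Sh : S h = 0.
  have [T0 _ T_fun] := leftprod_operator; apply: (T_fun 0) => //.
  apply: leftprod_of_adjoint => w v Bwv; rewrite hdot0r -S_sym hC//.
  by exists (S v); apply/sandwichP; exists v; rewrite ?SS.
by apply/hdotxx_eq0/hC; exists 0; apply/sandwichP; exists 0; rewrite ?Sh ?linear0.
Qed.

(** The vectors [S w], with [w] in the domain of [B A], show that an element
[(u, v)] of the adjoint satisfies [S v = S (S b)] for [b := B (S u)]. The
difference [v - S b] then lies in the kernel of [S], to which both [v] and [S b]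
are orthogonal. *)
Lemma sandwich_selfadjoint : selfadjoint C.
Proof.
split; [exact: sandwich_operator|exact: sandwich_dom_dense|].
apply/seteqP; split=> [[u v] h|[u v] /sandwichP[b' hb' ->] x y]; last first.
  move=> /sandwichP[b hb ->] /=; rewrite S_sym -[RHS]S_sym.
  exact: selfadjoint_sym hb hb'.
have C0 z : S z = 0 -> C (z, 0).
  by move=> Sz; apply/sandwichP; exists 0; rewrite ?Sz ?linear0.
have /leftprodP [b Bub Sv] : T (S u, S v).
  apply: leftprod_of_adjoint => w v0 Bwv; rewrite -!S_sym; apply: h.
  by apply/sandwichP; exists v0; rewrite ?SS.
apply/sandwichP; exists b => //; apply/eqP; rewrite -subr_eq0; apply/eqP/hdotxx_eq0.
have Sd : S (v - S b) = 0 by rewrite linearB Sv SS subrr.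
have /= := h _ _ (C0 _ Sd); rewrite hdot0l => e.
by rewrite hdotDr hdotNr -e -S_sym Sd hdot0l subr0.
Qed.

Lemma sandwich_nonneg : nonneg C.
Proof. by move=> x y /sandwichP[b hb ->]; rewrite S_sym; exact: B_nonneg. Qed.

Lemma leftprod_sandwich_intertwine : mulop T (graph S) = mulop (graph S) C.
Proof.
apply/seteqP; split=> [[x y] [z /= zE /leftprodP[b hb ->]]|[x y] [c /= /sandwichP[b hb ->] yE]].
  by exists (S b) => /=; [apply/sandwichP; exists b; rewrite // -zE | rewrite /graph /= SS].
by exists (S x) => //=; apply/leftprodP; exists b => //; rewrite -SS; exact: yE.
Qed.

Let sqrt_inj : (forall f, exists b, f = S b) -> forall z, S z = 0 -> z = 0.
Proof.
move=> sur z Sz; have [w zE] := sur z; apply: hdotxx_eq0.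
by rewrite {1}zE S_sym Sz hdot0r.
Qed.

Let C_closed : approx_closed C := selfadjoint_closed sandwich_selfadjoint.

(** A solution of [(T - mu) x = S g] gives the solution
[z := mu^-1 (S B x - g)] of [(C - mu) z = g], for [S z] is then [x]. For
[mu = 0], surjectivity of [T] makes [S] bijective and [z] is the preimage of
[x] under [S]. *)
Lemma resolvent_leftprod_sandwich mu : resolvent_set T mu -> resolvent_set C mu.
Proof.
move=> /(resolventP mu leftprod_operator T_closed) [sur inj].
apply/(resolventP mu sandwich_operator C_closed).
have [mu0|mu0] := eqVneq mu 0.
  have S_sur f : exists b, f = S b.
    by have [x /leftprodP[b _]] := sur f; rewrite mu0 scale0r addr0 -SS; exists (S b).
  have S_inj := sqrt_inj S_sur.
  split=> [g|z /sandwichP[b Bb]].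
    have [x /leftprodP[b Bb]] := sur (S g); rewrite mu0 scale0r addr0 => e.
    have [z xE] := S_sur x; exists z; apply/sandwichP; exists b; first by rewrite -xE.
    rewrite scale0r addr0; apply/eqP; rewrite -subr_eq0; apply/eqP/S_inj.
    by rewrite linearB SS -e subrr.
  rewrite mu0 scale0r => e; apply/S_inj/inj/leftprodP; exists b => //.
  by rewrite mu0 scale0r -SS -e linear0.
split=> [g|z /sandwichP[b Bb zE]].
  have [x /leftprodP[b Bb e]] := sur (S g).
  exists (mu^-1 *: (S b - g)); apply/sandwichP; exists b.
    by rewrite linearZ linearB /= SS -e [S g + _]addrC addrK scalerA mulVf// scale1r.
  by rewrite scalerA mulfV// scale1r addrC subrK.
have Sz : S z = 0.
  by apply/inj/leftprodP; exists b => //; rewrite -SS -zE linearZ.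
rewrite Sz in Bb; rewrite (B_fun Bb B0) linear0 in zE.
by move/eqP: zE; rewrite scaler_eq0 (negPf mu0) => /eqP.
Qed.

(** For [g] in the domain of [B], a solution of [(C - mu) z = S B g] gives the
solution [w := mu^-1 (S z - g)] of [(T - mu) w = g]. *)
Lemma resolvent_sandwich_leftprod mu nu :
  resolvent_set T nu -> resolvent_set C mu -> resolvent_set T mu.
Proof.
move=> /(resolventP nu leftprod_operator T_closed) [surT _].
move=> /(resolventP mu sandwich_operator C_closed) [sur inj].
apply/(resolventP mu leftprod_operator T_closed).
have [mu0|mu0] := eqVneq mu 0.
  have S_sur f : exists b, f = S b.
    by have [x /sandwichP[b _]] := sur f; rewrite mu0 scale0r addr0; exists b.
  have S_inj := sqrt_inj S_sur.
  split=> [f|x /leftprodP[b Bb]].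
    have [g ->] := S_sur f; have [z /sandwichP[b Bb]] := sur g.
    rewrite mu0 !scale0r !addr0 => e; exists (S z); apply/leftprodP; exists b => //.
    by rewrite scale0r addr0 e SS.
  rewrite mu0 scale0r -SS => /esym/S_inj e; have [z xE] := S_sur x.
  rewrite xE (inj z) ?linear0//; apply/sandwichP; exists b; first by rewrite -xE.
  by rewrite mu0 scale0r e.
split=> [f|x /leftprodP[b Bb xE]].
  have [y /leftprodP[c Bc e]] := surT f.
  (* [f] differs from [(T - mu) y] by [g], which is in the domain of [B]. *)
  pose g := (mu - nu) *: y; pose k := (mu - nu) *: c.
  have Bk : B (g, k) by exact: BZ.
  have [z /sandwichP[b Bb eb]] := sur (S k).
  pose w := mu^-1 *: (S z - g).
  have Bw : B (w, mu^-1 *: (b - k)).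
    have := BZ mu^-1 (BD (-1) Bk Bb).
    by rewrite !scaleN1r !(addrC (- _)).
  exists (y + w); apply/leftprodP; exists (c + mu^-1 *: (b - k)).
    by have := BD 1 Bc Bw; rewrite !scale1r.
  have AE : A (mu^-1 *: (b - k)) = S z.
    have e2 : S (S k + mu *: z) = S (S k) + mu *: S z.
      by rewrite [LHS]linearD; congr (_ + _); exact: linearZ.
    rewrite linearZ linearB /= -!SS -eb e2 [S (S k) + _]addrC addrK.
    by rewrite scalerA mulVf// scale1r.
  rewrite [RHS]linearD AE -e scalerDr /w scalerA mulfV// scale1r /g scalerBl opprB.
  by rewrite [mu *: y + _]addrC -addrA subrK [S z + _]addrC addrA.
have Sz : S (mu^-1 *: S b) = x.
  by rewrite linearZ /= SS -xE scalerA mulVf// scale1r.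
rewrite -Sz (inj (mu^-1 *: S b)) ?linear0//; apply/sandwichP; exists b; rewrite ?Sz//.
by rewrite scalerA mulfV// scale1r.
Qed.

End Products.

Theorem proposition2p5 (R : realType) (H : hilbertType R)
    (T B : set (H * H)) (A : {linear H -> H})
    (hT : Llplus2 T) (hTAB : T = mulop (graph A) B)
    (hA : bounded_nonneg A) (hB : selfadjoint B) (hB0 : nonneg B) :
  let A12 := sqrtop A in
  let C := mulop (graph A12) (mulop B (graph A12)) in
  [/\ selfadjoint C,
      presimilar T C A12 &
      resolvent_set T !=set0 ->
      spectrum T = spectrum C /\ spectrum C `<=` [set z : R[i] | 0 <= z]].
Proof.
have [hS SS] := sqrtopP hA; have [bS _ _] := hS.
have S_sym x y := bounded_nonneg_sym x y hS.
have cT : approx_closed (mulop (graph A) B).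
  by rewrite -hTAB; apply: closed_approx; case: hT.
move=> A12 C; have sC : selfadjoint C := sandwich_selfadjoint S_sym SS hB cT.
split=> //.
  by split => //; rewrite hTAB; exact: leftprod_sandwich_intertwine.
move=> [nu hnu]; split.
  apply/seteqP; split=> mu; apply: contra_not; rewrite hTAB.
    by apply: (resolvent_sandwich_leftprod S_sym SS hB cT (nu := nu)); rewrite -hTAB.
  exact: resolvent_leftprod_sandwich.
move=> mu /=; apply: contra_notP => nmu.
by apply: nonneg_selfadjoint_resolvent => //; exact: sandwich_nonneg.
Qed.
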